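(* Let $n\ge1$, $d\ge1$, $F_1,\dots,F_n:\mathbb{R}^d\to\mathbb{R}^d$, $F=\frac1n\sum_iF_i$, with $F$ $\mu$-strongly monotone ($\mu>0$) and each $F_i$ $L_i$-Lipschitz; let $z_*$ be the solution of $F(z_* )=0$, $L_{max}=\max_iL_i$, $\sigma_*^2=\frac1n\sum_i\|F_i(z_* )\|^2$, and $\gamma_{1,max}=\frac{\mu}{10L_{max}^2\sqrt{10n^2+2n+54}}$. Run SEG-RR (defined in the context) with epoch-dependent step sizes $\gamma_{2,k}=2\gamma_{1,k}$, where $\gamma_{1,k}=\gamma_{1,max}$ for $k<k^*:=\lceil\frac{64}{\mu^2\gamma_{1,max}^2}\rceil$ and $\gamma_{1,k}=\frac{4(2k+1)}{\mu(k+1)^2}$ for $k\ge k^*$. Then for $K\ge k^*$, $$\mathbb{E}\|z_0^{K+1}-z_*\|^2\le\frac{(k^* )^2e^{-\frac{\mu n\gamma_{1,max}}{4}}}{(K+1)^2}\|z_0-z_*\|^2+\frac{96L_{max}^2(29+n)\sigma_*^2}{\mu^2(K+1)^2}\Big(\gamma_{1,max}^2(k^* )^2+\frac{128}{\mu^2}K\Big).$$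
   Context: $\mu$-strongly monotone: $\langle F(z_1)-F(z_2),z_1-z_2\rangle\ge\mu\|z_1-z_2\|^2$. SEG-RR with epoch step sizes $\gamma_{1,k},\gamma_{2,k}>0$: set $z_0^0=z_0$; for each epoch $k=0,1,\dots$ draw a permutation $\pi^k$ of $\{1,\dots,n\}$ uniformly at random, independently of the past; for $i=0,\dots,n-1$ set $\bar z_i^k=z_i^k-\gamma_{2,k}F_{\pi_i^k}(z_i^k)$, $z_{i+1}^k=z_i^k-\gamma_{1,k}F_{\pi_i^k}(\bar z_i^k)$; then $z_0^{k+1}=z_n^k$. $\mathbb{E}$ is expectation over all permutations. *)

(* Defs.v *)
From HB Require Import structures.
From mathcomp Require Import all_boot all_order all_algebra all_fingroup.
From mathcomp Require Import reals sequences exp.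
Set Implicit Arguments. Unset Strict Implicit. Unset Printing Implicit Defensive.
Import Order.TTheory GRing.Theory Num.Theory.
Local Open Scope ring_scope.

Section Defs.
Variables (R : realType) (n d : nat).
Local Notation vec := 'rV[R]_d.

Definition dotv (x y : vec) : R := \sum_(j < d) x ord0 j * y ord0 j.
Definition normv (x : vec) : R := Num.sqrt (dotv x x).

Definition mean_op (F : 'I_n -> vec -> vec) (x : vec) : vec :=
  n%:R^-1 *: \sum_(i < n) F i x.

Definition strongly_monotone (G : vec -> vec) (mu : R) : Prop :=
  forall z1 z2, dotv (G z1 - G z2) (z1 - z2) >= mu * (normv (z1 - z2)) ^+ 2.

Definition lipschitz (G : vec -> vec) (L : R) : Prop :=
  forall x y, normv (G x - G y) <= L * normv (x - y).

Definition seg_step (F : 'I_n -> vec -> vec) (g1 g2 : R) (pi : {perm 'I_n})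
  (z : vec) (i : 'I_n) : vec :=
  let zb := z - g2 *: F (pi i) z in z - g1 *: F (pi i) zb.

Definition seg_epoch (F : 'I_n -> vec -> vec) (g1 g2 : R) (pi : {perm 'I_n})
  (z : vec) : vec := foldl (seg_step F g1 g2 pi) z (enum 'I_n).

Fixpoint seg_rr (F : 'I_n -> vec -> vec) (g1 g2 : nat -> R)
  (pis : nat -> {perm 'I_n}) (z0 : vec) (k : nat) : vec :=
  if k is k'.+1 then
    seg_epoch F (g1 k') (g2 k') (pis k') (seg_rr F g1 g2 pis z0 k')
  else z0.

Definition Eperm (K : nat) (f : (nat -> {perm 'I_n}) -> R) : R :=
  #|{ffun 'I_K.+1 -> {perm 'I_n}}|%:R^-1 *
  \sum_(p : {ffun 'I_K.+1 -> {perm 'I_n}}) f (fun k => p (inord k)).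
End Defs.

(* Main.v *)
(** Over one epoch the iterate moves by [- g1 * n * F z] plus the error caused by
    evaluating each [F_i] at the drifted half-step instead of at the epoch start
    [z].  Strong monotonicity contracts the main part, and Young's inequality
    charges the error to that contraction.  The squared drift of the half-steps
    is controlled by the partial sums of [F_(pi j) zstar], whose mean square
    under a uniform permutation is at most [\sum_i |F_i zstar|^2], because
    sampling without replacement from vectors of zero sum is negatively
    correlated.  The resulting recursion
    [E_(k+1) <= (1 - t_k) E_k + t_k C g1_k^2], [t_k = g1_k * mu * n / 4], is
    iterated geometrically up to [kstar]; afterwards
    [1 - t_k <= k^2 / (k + 1)^2], so [k^2 E_k] telescopes. *)
Require Import Defs.
From HB Require Import structures.
From mathcomp Require Import all_boot all_order all_algebra all_fingroup.
From mathcomp Require Import reals sequences exp.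
From mathcomp Require Import ring lra.
Import Order.TTheory GRing.Theory Num.Theory.
Local Open Scope ring_scope.

(** * Inner product, squared norm and Young's inequality *)

Section InnerProduct.
Variables (R : realType) (d : nat).
Implicit Types x y z : 'rV[R]_d.

Definition sqn x : R := dotv x x.

Lemma dotvC x y : dotv x y = dotv y x.
Proof. by apply: eq_bigr => j _; rewrite mulrC. Qed.

Lemma dotvDl x y z : dotv (x + y) z = dotv x z + dotv y z.
Proof. by rewrite -big_split; apply: eq_bigr => j _; rewrite mxE mulrDl. Qed.

Lemma dotvZl a x z : dotv (a *: x) z = a * dotv x z.
Proof. by rewrite [RHS]mulr_sumr; apply: eq_bigr => j _; rewrite mxE mulrA. Qed.

Lemma dotvDr z x y : dotv z (x + y) = dotv z x + dotv z y.
Proof. by rewrite !(dotvC z) dotvDl. Qed.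

Lemma dotvZr z a x : dotv z (a *: x) = a * dotv z x.
Proof. by rewrite !(dotvC z) dotvZl. Qed.

Lemma dotv0l z : dotv 0 z = 0.
Proof. by rewrite -(scale0r 0) dotvZl mul0r. Qed.

Lemma dotv_suml (I : Type) (r : seq I) (P : pred I) (f : I -> 'rV[R]_d) z :
  dotv (\sum_(i <- r | P i) f i) z = \sum_(i <- r | P i) dotv (f i) z.
Proof. by elim/big_rec2: _ => [|i a b _ <-]; rewrite ?dotv0l ?dotvDl. Qed.

Lemma dotv_sumr (I : Type) (r : seq I) (P : pred I) (f : I -> 'rV[R]_d) z :
  dotv z (\sum_(i <- r | P i) f i) = \sum_(i <- r | P i) dotv z (f i).
Proof. by rewrite dotvC dotv_suml; apply: eq_bigr => i _; rewrite dotvC. Qed.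

Lemma sqn_ge0 x : 0 <= sqn x.
Proof. by apply: sumr_ge0 => j _; rewrite -expr2 sqr_ge0. Qed.

Lemma normv_sqr x : normv x ^+ 2 = sqn x.
Proof. by rewrite sqr_sqrtr // sqn_ge0. Qed.

Lemma sqnZ a x : sqn (a *: x) = a ^+ 2 * sqn x.
Proof. by rewrite /sqn dotvZl dotvZr mulrA expr2. Qed.

Lemma sqnN x : sqn (- x) = sqn x.
Proof. by rewrite -scaleN1r sqnZ sqrrN expr1n mul1r. Qed.

Lemma sqnD x y : sqn (x + y) = sqn x + 2 * dotv x y + sqn y.
Proof. by rewrite /sqn dotvDl !dotvDr (dotvC y x); ring. Qed.

Lemma young x y c : 0 < c -> 2 * dotv x y <= c * sqn x + c^-1 * sqn y.
Proof.
move=> c0; have := sqn_ge0 (c *: x - y).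
rewrite -scaleN1r sqnD !sqnZ dotvZl dotvZr sqrrN expr1n => H.
rewrite -(ler_pM2l c0) mulrDr mulVKf ?gt_eqF //; lra.
Qed.

Lemma sqnD_young x y c : 0 < c ->
  sqn (x + y) <= (1 + c) * sqn x + (1 + c^-1) * sqn y.
Proof. by move=> c0; have := young x y c c0; rewrite sqnD; lra. Qed.

Lemma sqnD_le x y : sqn (x + y) <= 2 * sqn x + 2 * sqn y.
Proof. by have := sqnD_young x y 1 ltr01; rewrite invr1; lra. Qed.

(** Induction on [r]: Young's inequality with weight the length [m] of the tail gives the head the
    factor [1 + m] and the tail the factor [(1 + m^-1) * m = m + 1]. An empty tail is treated apart,
    since the weight must be positive. *)
Lemma sqn_sum_le (I : Type) (r : seq I) (P : pred I) (f : I -> 'rV[R]_d) :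
  sqn (\sum_(i <- r | P i) f i) <= (size r)%:R * \sum_(i <- r | P i) sqn (f i).
Proof.
elim: r => [|i r IH]; first by rewrite !big_nil /sqn dotv0l mulr0.
have S0 : 0 <= \sum_(j <- r | P j) sqn (f j).
  by apply: sumr_ge0 => j _; apply: sqn_ge0.
rewrite !big_cons /= -[X in X%:R]addn1 natrD.
case: ifP => _; last by apply: le_trans IH _; rewrite ler_wpM2r // lerDl.
case: r IH S0 => [|k r] IH S0; first by rewrite !big_nil /= !addr0 add0r mul1r.
have n0 : 0 < (size (k :: r))%:R :> R by rewrite ltr0n.
apply: le_trans (sqnD_young _ _ _ n0) _.
move: IH; set m := _%:R; set T := \sum_(_ <- _ | _) sqn _ => IH.
have : (1 + m^-1) * sqn (\sum_(j <- k :: r | P j) f j) <= (1 + m^-1) * (m * T).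
  by rewrite ler_wpM2l // addr_ge0 ?invr_ge0 // ltW.
have -> : (1 + m^-1) * (m * T) = (m + 1) * T.
  by rewrite mulrA mulrDl mul1r mulVf ?gt_eqF.
by lra.
Qed.

End InnerProduct.

Arguments sqn {R d}.

(** * Sampling without replacement from vectors of zero sum *)

Section Shuffling.
Variables (R : realType) (n d : nat) (v : 'I_n -> 'rV[R]_d).
Hypothesis v_sum0 : \sum_i v i = 0.

(** Up to the factor [n!], the correlation of positions [j] and [l] under a uniform permutation. *)
Definition paircorr (j l : 'I_n) : R :=
  \sum_(s : {perm 'I_n}) dotv (v (s j)) (v (s l)).

(** A uniform permutation composed with the fixed [t] is again uniform. *)
Lemma paircorr_perm (t : {perm 'I_n}) j l :
  paircorr (t j) (t l) = paircorr j l.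
Proof.
rewrite [RHS](reindex_inj (mulgI t)).
by apply: eq_bigr => s _; rewrite !permM.
Qed.

Lemma sum_perm (W : nmodType) (f : 'I_n -> W) (s : {perm 'I_n}) :
  \sum_j f (s j) = \sum_j f j.
Proof. by rewrite [RHS](reindex_inj (@perm_inj _ s)). Qed.

Lemma paircorr_diag_ge0 j : 0 <= paircorr j j.
Proof. by apply: sumr_ge0 => s _; apply: sqn_ge0. Qed.

Lemma sum_paircorr_diag :
  \sum_j paircorr j j = (n`!)%:R * \sum_j sqn (v j).
Proof.
rewrite exchange_big /=.
under eq_bigr => s _ do rewrite (sum_perm _ (fun j => dotv (v j) (v j))).
by rewrite sumr_const card_Sn -[LHS]mulr_natl.
Qed.

Lemma sum_paircorr j : \sum_l paircorr j l = 0.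
Proof.
rewrite exchange_big /= big1 // => s _.
by rewrite -dotv_sumr (sum_perm _ v) v_sum0 dotvC dotv0l.
Qed.

(* By symmetry the off-diagonal correlations are all equal, and together with
   the nonnegative diagonal one they add up to 0. *)
Lemma paircorr_offdiag_le0 j l : j != l -> paircorr j l <= 0.
Proof.
move=> jl; rewrite leNgt; apply/negP => H.
have := sum_paircorr j; apply/eqP; rewrite gt_eqF //.
rewrite (bigD1 l) //= ltr_pwDl // sumr_ge0 // => m ml.
have [->|jm] := eqVneq m j; first exact: paircorr_diag_ge0.
have := paircorr_perm (tperm l m) j l.
by rewrite tpermL tpermD // 1?eq_sym // => ->; apply: ltW.
Qed.

(** Expanding the square gives the correlations over pairs of positions in [P]. The off-diagonal
    ones are nonpositive and dropped; the diagonal ones are completed to all positions. *)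
Lemma shuffled_sum_le (P : pred 'I_n) :
  \sum_(s : {perm 'I_n}) sqn (\sum_(j | P j) v (s j))
    <= (n`!)%:R * \sum_j sqn (v j).
Proof.
have -> : \sum_(s : {perm 'I_n}) sqn (\sum_(j | P j) v (s j))
        = \sum_(j | P j) \sum_(l | P l) paircorr j l.
  rewrite [RHS](eq_bigr (fun j =>
    \sum_(s : {perm 'I_n}) \sum_(l | P l) dotv (v (s j)) (v (s l)))); last first.
    by move=> j _; rewrite exchange_big.
  rewrite [RHS]exchange_big; apply: eq_bigr => s _.
  by rewrite /sqn dotv_suml; apply: eq_bigr => j _; rewrite dotv_sumr.
rewrite -sum_paircorr_diag [leRHS](bigID P) /= -[leLHS]addr0 lerD //; last first.
  by apply: sumr_ge0 => j _; apply: paircorr_diag_ge0.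
apply: ler_sum => j Pj; rewrite (bigD1 j) //= gerDl.
by apply: sumr_le0 => l /andP[_ lj]; rewrite paircorr_offdiag_le0 // eq_sym.
Qed.

End Shuffling.

(** * Sums over the operators and the scalar inequalities of one epoch *)

Lemma sqn_sum_ord (R : realType) (n d : nat) (P : pred 'I_n)
    (f : 'I_n -> 'rV[R]_d) :
  sqn (\sum_(i | P i) f i) <= n%:R * \sum_(i | P i) sqn (f i).
Proof.
apply: le_trans (sqn_sum_le _ _ _ _ _ _) _.
by rewrite /index_enum unlock -enumT -cardT card_ord.
Qed.

Lemma sum_affine (R : realType) (n : nat) (a b : R) (f : 'I_n -> R) :
  \sum_i (a + b * f i) = n%:R * a + b * \sum_i f i.
Proof. by rewrite big_split /= -mulr_sumr sumr_const card_ord -[_ *+ n]mulr_natl. Qed.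

(* In both lemmas [N] is the number of operators and [D] the squared distance
   to the solution at the start of the epoch; [W] and [SA] are the total squared
   drifts of the half-steps and of the iterates, [Q] and [V] the noise terms, and
   [p = (g L)^2], [c = g L^2 / mu], [x = g mu N]. *)
Section EpochScalars.
Variable R : realType.
Implicit Types N p c x g D W SA Q V : R.

Lemma epoch_drift_scalar N p D W SA Q V :
  1 <= N -> 0 <= p -> 0 <= D -> 0 <= Q -> 0 <= V -> 0 <= W ->
  p * (100 * (10 * N ^+ 2 + 2 * N + 54)) <= 1 ->
  SA <= 4 * N ^+ 2 * p * (W + N * D) + 2 * Q ->
  W <= (2 + 32 * p) * SA + 32 * p * N * D + 16 * V ->
  W <= p * N * (10 * N ^+ 2 + 34) * D + 5 * Q + 17 * V.
Proof.
move=> N1 p0 D0 Q0 V0 W0 hp hSA hW.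
have N0 : 0 <= N by lra.
have pN0 : 0 <= p * N by rewrite mulr_ge0.
have pN2 : p * N ^+ 2 <= 1 / 1000 by lra.
have pN2_0 : 0 <= p * N ^+ 2 by rewrite mulr_ge0 ?sqr_ge0.
have p_le : p <= 1 / 5400 by lra.
pose X := p * N * D; have X0 : 0 <= X by rewrite mulr_ge0.
pose Y := p * N ^+ 2 * N * D; have Y0 : 0 <= Y by rewrite !mulr_ge0 ?sqr_ge0.
(* [SA] itself contains [W], but with a coefficient so small that this part can be absorbed on the
   left. The constants 10, 34, 5 and 17 round up what the division by [1 - (201 / 100) * (4 / 1000)]
   yields. *)
have PW : p * N ^+ 2 * W <= 1 / 1000 * W by rewrite ler_wpM2r.
have hT : 4 * N ^+ 2 * p * (W + N * D) + 2 * Q <= 4 / 1000 * W + 4 * Y + 2 * Q.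
  by rewrite /Y; lra.
have T0 : 0 <= 4 / 1000 * W + 4 * Y + 2 * Q by lra.
have p2_0 : 0 <= 2 + 32 * p by lra.
have H1 := ler_wpM2l p2_0 (le_trans hSA hT).
have H2 : (2 + 32 * p) * (4 / 1000 * W + 4 * Y + 2 * Q)
       <= (201 / 100) * (4 / 1000 * W + 4 * Y + 2 * Q).
  by rewrite ler_wpM2r //; lra.
have -> : p * N * (10 * N ^+ 2 + 34) * D = 10 * Y + 34 * X by rewrite /Y /X; ring.
have : W <= (201 / 100) * (4 / 1000 * W + 4 * Y + 2 * Q) + 32 * X + 16 * V.
  by apply: le_trans hW _; rewrite lerD2r /X !mulrA in H1 H2 *; lra.
by lra.
Qed.

Lemma epoch_descent_scalar N c x D W Q V :
  1 <= N -> 0 < c -> 0 <= D -> 0 <= Q -> 0 <= V ->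
  0 < x -> x <= c * N -> c ^+ 2 * (100 * (10 * N ^+ 2 + 2 * N + 54)) <= 1 ->
  W <= c * x * (10 * N ^+ 2 + 34) * D + 5 * Q + 17 * V ->
  (1 + x) * ((1 - 2 * x + c * N * x) * D + c * W)
    <= (1 - x / 4) * D + c * (6 * Q + 18 * V).
Proof.
move=> N1 c0 D0 Q0 V0 x0 xcN hc hW.
have y_le : c * N <= 1 / 30.
  have cN0 : 0 <= c * N by rewrite mulr_ge0 // ltW // (lt_le_trans ltr01).
  have : (c * N) ^+ 2 <= (1 / 30) ^+ 2.
    have c2 : 0 <= c ^+ 2 by rewrite sqr_ge0.
    have c2N : 0 <= c ^+ 2 * N by rewrite mulr_ge0 //; lra.
    by rewrite exprMn; lra.
  by rewrite ler_pXn2r // nnegrE; lra.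
have hc2 : c ^+ 2 * (10 * N ^+ 2 + 34) <= 1 / 100.
  have c2 : 0 <= c ^+ 2 by rewrite sqr_ge0.
  have c2N : 0 <= c ^+ 2 * N by rewrite mulr_ge0 //; lra.
  by lra.
pose X := x * D; have X0 : 0 <= X by rewrite mulr_ge0 // ltW.
have cW : c * W <= 1 / 100 * X + 5 * (c * Q) + 17 * (c * V).
  have := ler_wpM2l (ltW c0) hW; have := ler_wpM2r X0 hc2.
  by rewrite /X; lra.
have yX : c * N * X <= 1 / 30 * X by rewrite ler_wpM2r.
have cQ0 : 0 <= c * Q by rewrite mulr_ge0 // ltW.
have cV0 : 0 <= c * V by rewrite mulr_ge0 // ltW.
(* Of the contraction [2 * x], [19 / 10 * x] survives the errors. The factor [1 + x] then costs one
   more [x], which still leaves more than [x / 4]; as [x <= 1 / 30], it raises 5 and 17 to at most 6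
   and 18. *)
have H : (1 - 2 * x + c * N * x) * D + c * W
      <= D - 19 / 10 * X + 5 * (c * Q) + 17 * (c * V).
  by rewrite /X in X0 cW yX *; lra.
have x1 : 0 <= 1 + x by lra.
apply: le_trans (ler_wpM2l x1 H) _.
have xX0 : 0 <= x * X by rewrite mulr_ge0 // ltW.
have xle : x <= 1 / 30 by lra.
have xcQ := ler_wpM2r cQ0 xle; have xcV := ler_wpM2r cV0 xle.
by rewrite /X in X0 xX0 *; lra.
Qed.

End EpochScalars.

(** * One epoch of the method, first for a fixed permutation, then averaged *)

Section Epoch.
Variables (R : realType) (n d : nat) (F : 'I_n -> 'rV[R]_d -> 'rV[R]_d).
Variables (mu L : R) (zs : 'rV[R]_d).
Local Notation N := (n%:R : R).
Hypotheses (n_gt0 : (0 < n)%N) (mu_gt0 : 0 < mu).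
Hypothesis F_mono : strongly_monotone (mean_op F) mu.
Hypothesis F_lip : forall i, lipschitz (F i) L.
Hypothesis F_zs : mean_op F zs = 0.

Let N_ge1 : 1 <= N. Proof. by rewrite ler1n. Qed.
Let N_gt0 : 0 < N. Proof. by rewrite ltr0n. Qed.
Let N_neq0 : N != 0. Proof. by rewrite gt_eqF. Qed.

Lemma sqn_lip i x y : sqn (F i x - F i y) <= L ^+ 2 * sqn (x - y).
Proof.
have := F_lip i x y; rewrite -!normv_sqr -exprMn => H.
by rewrite lerXn2r // nnegrE ?sqrtr_ge0 // (le_trans _ H) ?sqrtr_ge0.
Qed.

Lemma sum_mean_op x : \sum_i F i x = N *: mean_op F x.
Proof. by rewrite scalerA divff // scale1r. Qed.

Lemma sum_zs : \sum_i F i zs = 0.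
Proof. by rewrite sum_mean_op F_zs scaler0. Qed.

Lemma sqn_sum_zs x :
  sqn (\sum_i F i x) <= N ^+ 2 * L ^+ 2 * sqn (x - zs).
Proof.
have -> : \sum_i F i x = \sum_i (F i x - F i zs) by rewrite sumrB sum_zs subr0.
apply: le_trans (sqn_sum_ord _ _ _ _ _) _.
rewrite -[leRHS]mulrA [N ^+ 2]expr2 -[leRHS]mulrA ler_wpM2l ?(ltW N_gt0) //.
have -> : N * (L ^+ 2 * sqn (x - zs)) = \sum_(i < n) L ^+ 2 * sqn (x - zs).
  by rewrite sumr_const card_ord -[RHS]mulr_natl.
by apply: ler_sum => i _; apply: sqn_lip.
Qed.

Lemma dotv_sum_zs x : N * mu * sqn (x - zs) <= dotv (\sum_i F i x) (x - zs).
Proof.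
have := F_mono x zs; rewrite F_zs subr0 normv_sqr => H.
by rewrite sum_mean_op dotvZl -mulrA ler_wpM2l ?(ltW N_gt0).
Qed.

(** Compare the monotonicity and Lipschitz bounds at [zs + w] for a nonzero [w], which exists
    because [d] is positive. Young's inequality with weight [N * mu] stands in for
    Cauchy-Schwarz. *)
Lemma strong_monotonicity_le_lip : (0 < d)%N -> mu ^+ 2 <= L ^+ 2.
Proof.
move=> d_gt0; pose w : 'rV[R]_d := const_mx 1.
have q_gt0 : 0 < sqn w.
  rewrite /sqn /dotv (eq_bigr (fun=> 1)); last by move=> j _; rewrite mxE mulr1.
  by rewrite sumr_const card_ord ltr0n.
have wE : (zs + w) - zs = w by rewrite addrC addKr.
have := dotv_sum_zs (zs + w); have := sqn_sum_zs (zs + w).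
rewrite wE; set u := \sum_i _ => uL uw.
have Nmu : 0 < N * mu by rewrite mulr_gt0.
have := young _ _ w u (N * mu) Nmu; rewrite dotvC => uy.
have {uy} : N * mu * sqn w <= (N * mu)^-1 * sqn u by lra.
rewrite ler_pdivlMl // => H; have := le_trans H uL.
by rewrite mulrA -expr2 exprMn ler_pM2r // ler_pM2l // exprn_gt0.
Qed.

Section Iterates.
Variables (g : R) (s : {perm 'I_n}) (z : 'rV[R]_d).

Definition seg_iter (m : nat) : 'rV[R]_d :=
  foldl (seg_step F g (2 * g) s) z (take m (enum 'I_n)).

Definition seg_half (i : 'I_n) : 'rV[R]_d :=
  seg_iter i - (2 * g) *: F (s i) (seg_iter i).

Lemma seg_iterE m : (m <= n)%N ->
  seg_iter m = z - g *: \sum_(j < n | (j < m)%N) F (s j) (seg_half j).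
Proof.
elim: m => [|m IH] mn.
  by rewrite /seg_iter take0 big_pred0 // scaler0 subr0.
pose i := Ordinal mn.
have -> : seg_iter m.+1 = seg_iter m - g *: F (s i) (seg_half i).
  rewrite /seg_iter (take_nth i) ?size_enum_ord // -cats1 foldl_cat /=.
  by rewrite -{2}[m]/(val i) nth_ord_enum.
rewrite IH ?(ltnW mn) // [in RHS](bigD1 i) //= [in RHS]scalerDr [g *: F _ _ + _]addrC opprD addrA.
congr (_ - _ *: _ - _); apply: eq_bigl => j.
by rewrite ltnS andbC -val_eqE /= -ltn_neqAle.
Qed.

Lemma seg_epochE : seg_epoch F g (2 * g) s z = seg_iter n.
Proof. by rewrite /seg_iter take_oversize // size_enum_ord. Qed.

(** Drifts [A] and [B] are measured from the start [z] of the epoch; [S i] is the noise of the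
    operators used before step [i]. *)
Local Notation D := (sqn (z - zs)).
Local Notation A i := (sqn (seg_iter i - z)).
Local Notation B i := (sqn (seg_half i - z)).
Local Notation W := (\sum_i B i).
Local Notation S i := (\sum_(j < n | (j < i)%N) F (s j) zs).

(** In the unrolled displacement, each operator value is compared with its value at [zs]. The
    differences are Lipschitz in [seg_half j - zs], split through [z]; the values at [zs] form
    [S i]. *)
Lemma iter_drift (i : 'I_n) :
  A i <= g ^+ 2 * (4 * N * L ^+ 2 * (W + N * D) + 2 * sqn (S i)).
Proof.
rewrite seg_iterE 1?ltnW // [z - g *: _]addrC addrK sqnN sqnZ.
rewrite ler_wpM2l ?sqr_ge0 //.
have -> : \sum_(j < n | (j < i)%N) F (s j) (seg_half j)
        = \sum_(j < n | (j < i)%N) (F (s j) (seg_half j) - F (s j) zs) + S i.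
  by rewrite -big_split; apply: eq_bigr => j _; rewrite /= subrK.
apply: le_trans (sqnD_le _ _ _ _) _.
rewrite lerD2r.
suff H : sqn (\sum_(j < n | (j < i)%N) (F (s j) (seg_half j) - F (s j) zs))
          <= N * (L ^+ 2 * (2 * W + 2 * (N * D))) by lra.
apply: le_trans (sqn_sum_ord _ _ _ _ _) _; rewrite ler_wpM2l ?(ltW N_gt0) //.
have -> : L ^+ 2 * (2 * W + 2 * (N * D))
        = \sum_(j < n) L ^+ 2 * (2 * B j + 2 * D).
  rewrite -mulr_sumr big_split /= -mulr_sumr sumr_const card_ord.
  by rewrite -[(2 * D) *+ n]mulr_natl mulrCA.
rewrite [leRHS](bigID (fun j : 'I_n => (j < i)%N)) /=.
rewrite -[leLHS]addr0 lerD //; last first.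
  apply: sumr_ge0 => j _.
  by rewrite mulr_ge0 ?sqr_ge0 // addr_ge0 // mulr_ge0 // sqn_ge0.
apply: ler_sum => j _; apply: le_trans (sqn_lip _ _ _) _.
rewrite ler_wpM2l ?sqr_ge0 // -[seg_half j - zs](subrKA z).
exact: sqnD_le.
Qed.

Lemma half_drift (i : 'I_n) :
  B i <= 2 * A i + 8 * g ^+ 2 * (4 * L ^+ 2 * (A i + D) + 2 * sqn (F (s i) zs)).
Proof.
have -> : seg_half i - z
        = (seg_iter i - z) + (- (2 * g)) *: F (s i) (seg_iter i).
  by rewrite scaleNr addrAC.
apply: le_trans (sqnD_le _ _ _ _) _; rewrite sqnZ.
have : sqn (F (s i) (seg_iter i))
        <= 4 * L ^+ 2 * (A i + D) + 2 * sqn (F (s i) zs).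
  rewrite -[F _ (seg_iter i)](subrK (F (s i) zs)).
  apply: le_trans (sqnD_le _ _ _ _) _; rewrite lerD2r.
  have := sqn_lip (s i) (seg_iter i) zs.
  have := sqnD_le _ _ (seg_iter i - z) (z - zs); rewrite subrKA => H1 H2.
  have : L ^+ 2 * sqn (seg_iter i - zs) <= L ^+ 2 * (2 * A i + 2 * D).
    by rewrite ler_wpM2l ?sqr_ge0.
  by lra.
move=> H; have : 8 * g ^+ 2 * sqn (F (s i) (seg_iter i)) <= 
  8 * g ^+ 2 * (4 * L ^+ 2 * (A i + D) + 2 * sqn (F (s i) zs)).
  by rewrite ler_wpM2l // mulr_ge0 // sqr_ge0.
by lra.
Qed.

Lemma epoch_descent : 0 < g ->
  sqn (seg_iter n - zs)
   <= (1 + g * mu * N) * ((1 - 2 * (g * mu * N) + g ^+ 2 * L ^+ 2 * N ^+ 2) * D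
        + g * L ^+ 2 / mu * W).
Proof.
move=> g_gt0; set x := g * mu * N.
have x_gt0 : 0 < x by rewrite !mulr_gt0.
pose e := \sum_j (F (s j) (seg_half j) - F (s j) z).
pose a := (z - zs) - g *: \sum_j F j z.
have -> : seg_iter n - zs = a + (- g) *: e.
  rewrite /a /e seg_iterE // (eq_bigl xpredT) => [|j]; last by rewrite ltn_ord.
  by rewrite sumrB (sum_perm _ _ (fun j => F j z)) scaleNr scalerBr opprB addrA subrK addrAC.
(* With the contraction rate [x] as weight, [1 + x^-1 = (1 + x) / x], so both parts carry the common
   factor [1 + x]. *)
apply: le_trans (sqnD_young _ _ _ _ _ x_gt0) _.
have He : sqn e <= N * (L ^+ 2 * W).
  apply: le_trans (sqn_sum_ord _ _ _ _ _) _; rewrite ler_wpM2l ?(ltW N_gt0) //.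
  by rewrite mulr_sumr; apply: ler_sum => j _; apply: sqn_lip.
have Ha : sqn a <= (1 - 2 * x + g ^+ 2 * L ^+ 2 * N ^+ 2) * D.
  rewrite /a -scaleNr sqnD sqnZ sqrrN dotvZr dotvC.
  have H1 := ler_wpM2l (sqr_ge0 g) (sqn_sum_zs z).
  have H2 := ler_wpM2l (ltW g_gt0) (dotv_sum_zs z).
  by rewrite /x; lra.
rewrite mulrDr; apply: lerD; first by rewrite ler_wpM2l // addr_ge0 // (ltW x_gt0).
rewrite sqnZ sqrrN.
have -> : (1 + x) * (g * L ^+ 2 / mu * W)
        = (1 + x^-1) * (g ^+ 2 * (N * (L ^+ 2 * W))).
  by rewrite /x; field; rewrite N_neq0 !gt_eqF.
by rewrite ler_wpM2l ?addr_ge0 ?invr_ge0 ?(ltW x_gt0) // ler_wpM2l // sqr_ge0.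
Qed.

Hypotheses (g_gt0 : 0 < g) (mu_le_L : mu ^+ 2 <= L ^+ 2).
(** The square of [g <= mu / (10 * L ^+ 2 * sqrt (10 * N ^+ 2 + 2 * N + 54))]. *)
Hypothesis g_small :
  g ^+ 2 * L ^+ 4 * (100 * (10 * N ^+ 2 + 2 * N + 54)) <= mu ^+ 2.

(** The drifts of iterates and half-steps bound each other; [epoch_drift_scalar] resolves this loop,
    and [epoch_descent_scalar] inserts the result into [epoch_descent]. *)
Lemma epoch_bound :
  sqn (seg_epoch F g (2 * g) s z - zs)
    <= (1 - g * mu * N / 4) * D
       + g ^+ 3 * L ^+ 2 / mu
         * (6 * (\sum_(i < n) sqn (S i)) + 18 * \sum_i sqn (F i zs)).
Proof.
set Q := \sum_(i < n) sqn (S i); set V := \sum_i sqn (F i zs).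
have W_ge0 : 0 <= W by apply: sumr_ge0 => i _; apply: sqn_ge0.
have Q_ge0 : 0 <= Q by apply: sumr_ge0 => i _; apply: sqn_ge0.
have V_ge0 : 0 <= V by apply: sumr_ge0 => i _; apply: sqn_ge0.
have D_ge0 := sqn_ge0 _ _ (z - zs).
have mu2_gt0 : 0 < mu ^+ 2 by rewrite exprn_gt0.
have g2_ge0 : 0 <= g ^+ 2 by rewrite sqr_ge0.
have L2_gt0 : 0 < L ^+ 2 by apply: lt_le_trans mu_le_L.
pose T := 100 * (10 * N ^+ 2 + 2 * N + 54).
have T_gt0 : 0 < T.
  by have := sqr_ge0 N; have := N_gt0; rewrite /T; lra.
pose p := g ^+ 2 * L ^+ 2; have p_ge0 : 0 <= p by rewrite mulr_ge0 // ltW.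
(* Multiplied by [L ^+ 2], this is [g_small] followed by [mu ^+ 2 <= L ^+ 2]. *)
have p_small : p * T <= 1.
  rewrite -(ler_pM2l L2_gt0) mulr1; apply: le_trans mu_le_L.
  by apply: le_trans g_small; rewrite le_eqVlt /p /T; apply/orP; left; apply/eqP; ring.
pose SA := \sum_(i < n) A i.
have hSA : SA <= 4 * N ^+ 2 * p * (W + N * D) + 2 * (g ^+ 2 * Q).
  have : SA <= \sum_(i < n) g ^+ 2 * (4 * N * L ^+ 2 * (W + N * D) + 2 * sqn (S i)).
    by apply: ler_sum => i _; apply: iter_drift.
  by rewrite -mulr_sumr sum_affine -/Q /p; lra.
have hW : W <= (2 + 32 * p) * SA + 32 * p * N * D + 16 * (g ^+ 2 * V).
  have : W <= \sum_(i < n) ((32 * p * D + 16 * g ^+ 2 * sqn (F (s i) zs))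
                             + (2 + 32 * p) * A i).
    by apply: ler_sum => i _; apply: le_trans (half_drift i) _; rewrite /p; lra.
  rewrite big_split /= sum_affine -mulr_sumr -/SA.
  by rewrite (sum_perm _ _ (fun i => sqn (F i zs))) -/V; lra.
have hW' := epoch_drift_scalar _ _ _ _ _ _ _ _ N_ge1 p_ge0 D_ge0
  (mulr_ge0 g2_ge0 Q_ge0) (mulr_ge0 g2_ge0 V_ge0) W_ge0 p_small hSA hW.
pose c := g * L ^+ 2 / mu; pose x := g * mu * N.
have c_gt0 : 0 < c by rewrite divr_gt0 // mulr_gt0.
have x_gt0 : 0 < x by rewrite !mulr_gt0.
have xc : x <= c * N.
  rewrite ler_pM2r // /c -mulrA ler_pM2l // ler_pdivlMr // -expr2.
have c_small : c ^+ 2 * T <= 1.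
  rewrite /c exprMn exprVn mulrAC ler_pdivrMr // mul1r exprMn -exprM.
  exact: g_small.
have pE : p * N = c * x by rewrite /p /c /x; field; rewrite gt_eqF.
rewrite pE in hW'.
rewrite seg_epochE; apply: le_trans (epoch_descent g_gt0) _.
have -> : g ^+ 2 * L ^+ 2 * N ^+ 2 = c * N * x.
  by rewrite /c /x; field; rewrite gt_eqF.
apply: le_trans (epoch_descent_scalar _ _ _ _ _ _ _ _ N_ge1 c_gt0 D_ge0
  (mulr_ge0 g2_ge0 Q_ge0) (mulr_ge0 g2_ge0 V_ge0) x_gt0 xc c_small hW') _.
rewrite lerD2l le_eqVlt; apply/orP; left; apply/eqP.
by rewrite /c; field; rewrite gt_eqF.
Qed.

End Iterates.

(** In [epoch_bound] only the prefix sums depend on [s]. Each of the [n] prefixes costs at most [V]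
    on average, which turns [6 * Q] into [6 * N * V]. *)
Lemma mean_epoch_bound g z : 0 < g -> mu ^+ 2 <= L ^+ 2 ->
  g ^+ 2 * L ^+ 4 * (100 * (10 * N ^+ 2 + 2 * N + 54)) <= mu ^+ 2 ->
  \sum_(s : {perm 'I_n}) sqn (seg_epoch F g (2 * g) s z - zs)
    <= (n`!)%:R * ((1 - g * mu * N / 4) * sqn (z - zs)
       + g ^+ 3 * L ^+ 2 / mu * (6 * N + 18) * \sum_i sqn (F i zs)).
Proof.
move=> g_gt0 muL g_small; set V := \sum_i sqn (F i zs).
pose Q (s : {perm 'I_n}) :=
  \sum_(i < n) sqn (\sum_(j < n | (j < i)%N) F (s j) zs).
have Q_le : \sum_s Q s <= (n`!)%:R * (N * V).
  rewrite exchange_big /= mulrCA.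
  have -> : N * ((n`!)%:R * V) = \sum_(i < n) (n`!)%:R * V.
    by rewrite sumr_const card_ord -[RHS]mulr_natl.
  apply: ler_sum => i _.
  exact: (shuffled_sum_le _ _ _ (fun i => F i zs) sum_zs (fun j => j < i)%N).
apply: le_trans (ler_sum _ (fun s _ => epoch_bound g s z g_gt0 muL g_small)) _.
set a := (1 - _) * _; set b := g ^+ 3 * _ / _.
have b_ge0 : 0 <= b.
  by rewrite divr_ge0 ?(ltW mu_gt0) // mulr_ge0 ?sqr_ge0 // exprn_ge0 // ltW.
rewrite big_split /= sumr_const card_Sn -mulr_sumr big_split /= -mulr_sumr.
rewrite sumr_const card_Sn -[a *+ _]mulr_natl -[(18 * _) *+ _]mulr_natl -/V.
have := ler_wpM2l b_ge0 Q_le; rewrite -/(Q _); lra.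
Qed.

End Epoch.

(* Left multiplication of one coordinate by a fixed group element is a
   bijection, so averaging over that element resamples the coordinate. *)
Lemma sum_resample (R : realType) (T : finType) (G : finGroupType) (k : T)
    (f : {ffun T -> G} -> R) :
  #|G|%:R * \sum_p f p
    = \sum_(p : {ffun T -> G}) \sum_(s : G) f [ffun i => if i == k then s else p i].
Proof.
pose shift (s : G) (p : {ffun T -> G}) :=
  [ffun i => if i == k then (s * p i)%g else p i].
have shift_inj s : injective (shift s).
  move=> p q /ffunP pq; apply/ffunP => i; have := pq i; rewrite !ffunE.
  by case: ifP => // _; apply: mulgI.
transitivity (\sum_(s : G) \sum_p f (shift s p)).
  rewrite [LHS]mulr_natl -sumr_const; apply: eq_bigr => s _.
  by rewrite (reindex_inj (shift_inj s)).
rewrite exchange_big; apply: eq_bigr => p _.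
rewrite [RHS](reindex_inj (mulIg (p k))); apply: eq_bigr => s _.
by congr f; apply/ffunP => i; rewrite !ffunE; case: eqP => // ->.
Qed.

(** * Expectation over the permutations of all epochs *)

Section Expectation.
Variables (R : realType) (n d : nat) (F : 'I_n -> 'rV[R]_d -> 'rV[R]_d).
Variables (g1 g2 : nat -> R) (z0 zs : 'rV[R]_d) (K : nat).

Definition mean_sqdist (k : nat) : R :=
  Eperm K (fun pis => sqn (seg_rr F g1 g2 pis z0 k - zs)).

Lemma mean_sqdist_ge0 k : 0 <= mean_sqdist k.
Proof.
by rewrite mulr_ge0 ?invr_ge0 ?ler0n // sumr_ge0 // => p _; apply: sqn_ge0.
Qed.

Lemma card_shuffles_gt0 :
  0 < #|{ffun 'I_K.+1 -> {perm 'I_n}}|%:R :> R.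
Proof. by rewrite ltr0n; apply/card_gt0P; exists [ffun=> 1%g]. Qed.

Lemma Eperm_cst (a : R) : @Eperm R n K (fun=> a) = a.
Proof.
rewrite /Eperm sumr_const -[a *+ _]mulr_natl mulrA mulVf ?mul1r //.
by rewrite gt_eqF // card_shuffles_gt0.
Qed.

Lemma mean_sqdist0 : mean_sqdist 0 = sqn (z0 - zs).
Proof. by rewrite /mean_sqdist /= Eperm_cst. Qed.

(** Causality: it makes the permutation of epoch [k] independent of the iterate that it acts on. *)
Lemma seg_rr_ext (p q : nat -> {perm 'I_n}) k :
  (forall j, (j < k)%N -> p j = q j) ->
  seg_rr F g1 g2 p z0 k = seg_rr F g1 g2 q z0 k.
Proof.
elim: k => //= k IH pq; rewrite pq // IH // => j jk.
by apply: pq; apply: ltnW.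
Qed.

(** Resampling coordinate [k] leaves the [k]-th iterate unchanged, so for each fixed past the
    hypothesis bounds the average over the fresh permutation. As [k <= K], [inord] keeps the earlier
    indices distinct from [k]. *)
Lemma mean_sqdist_step k (a b : R) : (k <= K)%N ->
  (forall z, \sum_(s : {perm 'I_n}) sqn (seg_epoch F (g1 k) (g2 k) s z - zs)
     <= (n`!)%:R * (a * sqn (z - zs) + b)) ->
  mean_sqdist k.+1 <= a * mean_sqdist k + b.
Proof.
move=> kK H; rewrite -[b in leRHS]Eperm_cst /mean_sqdist /Eperm.
rewrite mulrCA -mulrDr ler_pM2l ?invr_gt0 ?card_shuffles_gt0 //.
have fact_gt0R : 0 < (n`!)%:R :> R by rewrite ltr0n fact_gt0.
rewrite [a * _]mulr_sumr -big_split -(ler_pM2l fact_gt0R) [leRHS]mulr_sumr /=.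
rewrite -{1}card_Sn (sum_resample _ _ _ (inord k)).
apply: ler_sum => p _; apply: le_trans (H _).
apply: ler_sum => s _; rewrite /= ffunE eqxx.
rewrite (seg_rr_ext _ (fun j => p (inord j))) // => j jk.
rewrite ffunE -val_eqE /= !inordK ?ltnS // ?ltn_eqF //.
exact: leq_trans (ltnW jk) kK.
Qed.

End Expectation.

(** * The scalar recursion under constant, then decaying step sizes *)

Lemma decaying_step_recursion (R : realType) (E g : nat -> R)
    (mu N C G : R) (kst K : nat) :
  0 < mu -> 1 <= N -> 0 <= C -> (0 < kst <= K)%N ->
  (forall k, 0 <= E k) ->
  (forall k, (k < kst)%N -> g k = G) ->
  (forall k, (kst <= k)%N ->
     g k = 4 * (2 * k%:R + 1) / (mu * (k%:R + 1) ^+ 2)) ->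
  (forall k, 0 <= g k * mu * N / 4 <= 1) ->
  (forall k, (k <= K)%N ->
     E k.+1 <= (1 - g k * mu * N / 4) * E k
               + g k * mu * N / 4 * (C * g k ^+ 2)) ->
  E K.+1 <= kst%:R ^+ 2 * expR (- (mu * N * G / 4)) / (K%:R + 1) ^+ 2 * E 0%N
            + C / (K%:R + 1) ^+ 2 * (G ^+ 2 * kst%:R ^+ 2 + 128 / mu ^+ 2 * K%:R).
Proof.
move=> mu0 N1 C0 /andP[kst0 kstK] E0 gG gd gt step.
(* The level [C * G ^+ 2] is a fixed point of the recursion. Only one factor [1 - t] is kept, the
   others being at most 1; hence the single exponential in the conclusion. *)
have phase1 m : (m < kst)%N ->
    E m.+1 <= (1 - G * mu * N / 4) * E 0%N + C * G ^+ 2.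
  elim: m => [|m IH] mk.
    have := step 0%N (leq0n _); rewrite gG // => H.
    have /andP[_ t1] := gt 0%N; rewrite gG // in t1.
    have C2 : 0 <= C * G ^+ 2 by rewrite mulr_ge0 ?sqr_ge0.
    by have := ler_wpM2r C2 t1; lra.
  have := step m.+1 (leq_trans (ltnW mk) kstK).
  have /andP[t0 t1] := gt m.+1; rewrite gG // in t0 t1 *.
  set t := _ / 4 in IH t0 t1 *; set c := C * _ in IH *.
  have s0 : 0 <= 1 - t by lra.
  have H1 := ler_wpM2l s0 (IH (ltnW mk)).
  have H2 := mulr_ge0 (mulr_ge0 t0 s0) (E0 0%N).
  by lra.
have phase2 m : (kst + m <= K.+1)%N ->
    (kst + m)%:R ^+ 2 * E (kst + m)%N
      <= kst%:R ^+ 2 * E kst + m%:R * (C * (128 / mu ^+ 2)).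
  elim: m => [|m IH] mK; first by rewrite addn0 mul0r addr0.
  rewrite addnS in mK *; have {IH} := IH (ltnW mK).
  have := step _ mK; have := gt (kst + m)%N; have := E0 (kst + m)%N.
  have := gd _ (leq_addr m kst).
  move: (kst + m)%N => k; set gk := g k; rewrite -[k.+1]addn1 -[m.+1]addn1 !natrD.
  set x : R := k%:R; have x0 : 0 <= x by rewrite ler0n.
  move=> gkE Ek0 /andP[t0 t1]; set t := _ / 4 in t0 t1 * => stp IH.
  have x1 : x + 1 != 0 by rewrite gt_eqF //; lra.
  (* The step size is tuned to give exactly [(x + 1) ^+ 2 - x ^+ 2], the decrement needed for
     telescoping; [N >= 1] only increases [t]. *)
  have gk_t : (x + 1) ^+ 2 * (gk * mu / 4) = 2 * x + 1.
    by rewrite gkE; field; rewrite x1 gt_eqF.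
  have gkmu0 : 0 <= gk * mu / 4.
    rewrite gkE divr_ge0 // mulr_ge0 ?(ltW mu0) // divr_ge0 //; first by lra.
    by rewrite mulr_ge0 ?sqr_ge0 // ltW.
  have t_ge : 2 * x + 1 <= (x + 1) ^+ 2 * t.
    rewrite -gk_t ler_wpM2l ?sqr_ge0 //.
    by have := ler_wpM2l gkmu0 N1; rewrite /t; lra.
  have gk2 : (x + 1) ^+ 2 * gk ^+ 2 <= 64 / mu ^+ 2.
    have -> : (x + 1) ^+ 2 * gk ^+ 2
        = (2 * x + 1) ^+ 2 / (x + 1) ^+ 2 * (16 / mu ^+ 2).
      by rewrite gkE; field; rewrite x1 gt_eqF.
    have mu2 : 0 < mu ^+ 2 by rewrite exprn_gt0.
    have := sqr_ge0 (x + 1); rewrite le_eqVlt eq_sym expf_eq0 /= (negbTE x1) /= => x12.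
    have : (2 * x + 1) ^+ 2 / (x + 1) ^+ 2 <= 4 by rewrite ler_pdivrMr //; lra.
    have m0 : 0 <= 16 / mu ^+ 2 by rewrite divr_ge0 // ltW.
    by move=> /(ler_wpM2r m0); lra.
  have H1 := ler_wpM2l (sqr_ge0 (x + 1)) stp.
  have H2 := ler_wpM2r Ek0 t_ge.
  have H3 : (x + 1) ^+ 2 * (t * (C * gk ^+ 2)) <= C * (64 / mu ^+ 2).
    have := ler_wpM2l C0 gk2.
    have c0 : 0 <= C * ((x + 1) ^+ 2 * gk ^+ 2).
      by rewrite mulr_ge0 // mulr_ge0 ?sqr_ge0.
    by have := ler_wpM2r c0 t1; lra.
  (* One step adds at most [C * (64 / mu ^+ 2)]; this nonnegativity allows weakening 64 to 128. *)
  have H4 : 0 <= C * (64 / mu ^+ 2) by rewrite mulr_ge0 // divr_ge0 // sqr_ge0.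
  by lra.
have kstK1 : (kst <= K.+1)%N by apply: leqW.
have P2 : K.+1%:R ^+ 2 * E K.+1
    <= kst%:R ^+ 2 * E kst + (K.+1 - kst)%:R * (C * (128 / mu ^+ 2)).
  by have := phase2 (K.+1 - kst)%N; rewrite subnKC //; apply.
have : E kst <= expR (- (mu * N * G / 4)) * E 0%N + C * G ^+ 2.
  have := phase1 kst.-1; rewrite prednK // => /(_ (leqnn _)) H.
  apply: le_trans H _; rewrite lerD2r ler_wpM2r //.
  by apply: le_trans (expR_ge1Dx _); lra.
move=> /(ler_wpM2l (sqr_ge0 (kst%:R))) P1.
(* The number of decaying steps is at most [K] because [kst] is positive. *)
have mK : (K.+1 - kst)%:R <= K%:R :> R.
  by rewrite ler_nat leq_subLR -add1n leq_add2r.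
have C128 : 0 <= C * (128 / mu ^+ 2) by rewrite mulr_ge0 // divr_ge0 // sqr_ge0.
have P3 := ler_wpM2r C128 mK.
have K1 : 0 < (K%:R + 1) ^+ 2 :> R by rewrite exprn_gt0 // ltr_wpDl.
rewrite -(ler_pM2l K1).
rewrite -[K.+1%:R]natr1 in P2.
have -> : forall a b c e : R, (K%:R + 1) ^+ 2 *
   (a / (K%:R + 1) ^+ 2 * b + c / (K%:R + 1) ^+ 2 * e) = a * b + c * e.
  by move=> a b c e; field; rewrite gt_eqF // ltr_wpDl.
by lra.
Qed.

(** * Admissibility of the step sizes and assembly of the bound *)

Theorem theorem4 (R : realType) (n d : nat) (hn : (0 < n)%N) (hd : (0 < d)%N)
  (F : 'I_n -> 'rV[R]_d -> 'rV[R]_d) (mu : R) (L : 'I_n -> R)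
  (zstar z0 : 'rV[R]_d) :
  0 < mu ->
  strongly_monotone (mean_op F) mu ->
  (forall i, lipschitz (F i) (L i)) ->
  mean_op F zstar = 0 ->
  let Lmax := \big[Num.max/0]_(i < n) L i in
  let sigma2 := n%:R^-1 * \sum_(i < n) normv (F i zstar) ^+ 2 in
  let g1max := mu / (10 * Lmax ^+ 2 *
                     Num.sqrt (10 * n%:R ^+ 2 + 2 * n%:R + 54)) in
  let kstar : nat := `|Num.ceil (64 / (mu ^+ 2 * g1max ^+ 2))|%N in
  let g1 := fun k : nat => if (k < kstar)%N then g1max
                           else 4 * (2 * k%:R + 1) / (mu * (k%:R + 1) ^+ 2) in
  let g2 := fun k : nat => 2 * g1 k in
  forall K : nat, (kstar <= K)%N ->
  Eperm K (fun pis => normv (seg_rr F g1 g2 pis z0 K.+1 - zstar) ^+ 2)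
  <= (kstar%:R ^+ 2 * expR (- (mu * n%:R * g1max / 4))) / (K%:R + 1) ^+ 2
       * normv (z0 - zstar) ^+ 2
     + 96 * Lmax ^+ 2 * (29 + n%:R) * sigma2 / (mu ^+ 2 * (K%:R + 1) ^+ 2)
       * (g1max ^+ 2 * kstar%:R ^+ 2 + 128 / mu ^+ 2 * K%:R).
Proof.
move=> mu0 F_mono F_lipi F_zs Lmax sigma2 g1max kstar g1 g2 K kK.
have F_lip i : lipschitz (F i) Lmax.
  move=> x y; apply: le_trans (F_lipi i x y) _.
  by rewrite ler_wpM2r ?sqrtr_ge0 // /Lmax le_bigmax.
have L0 : 0 <= Lmax by rewrite /Lmax bigmax_ge_id.
(* This also forces [Lmax] to be nonzero, so [g1max] is a genuine quotient. *)
have muL := strong_monotonicity_le_lip _ _ _ _ _ _ _ hn mu0 F_mono F_lip F_zs hd.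
set N : R := n%:R in g1max kstar g1 g2 kK *.
have N1 : 1 <= N by rewrite ler1n.
have N0 : 0 < N by rewrite ltr0n.
have mu2 : 0 < mu ^+ 2 by rewrite exprn_gt0.
have L2 : 0 < Lmax ^+ 2 by apply: lt_le_trans muL.
pose T := 10 * N ^+ 2 + 2 * N + 54.
have T0 : 0 < T by have := sqr_ge0 N; rewrite /T; lra.
have G0 : 0 < g1max by rewrite divr_gt0 // mulr_gt0 ?sqrtr_gt0 // mulr_gt0.
(* [g1max] meets the smallness condition with equality. *)
have GE : g1max ^+ 2 * Lmax ^+ 4 * (100 * T) = mu ^+ 2.
  have sT : Num.sqrt T ^+ 2 = T by rewrite sqr_sqrtr // ltW.
  have sT0 : 0 < Num.sqrt T by rewrite sqrtr_gt0.
  rewrite -[in LHS]sT /g1max -/T; move: (Num.sqrt T) sT0 => r r0.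
  have Ln0 : Lmax != 0 by move: (gt_eqF L2); rewrite expf_eq0 /= => ->.
  by field; rewrite Ln0 gt_eqF.
have g_small (g : R) : 0 <= g -> g <= g1max ->
    g ^+ 2 * Lmax ^+ 4 * (100 * T) <= mu ^+ 2.
  move=> g0 gG; rewrite -GE -[leLHS]mulrA -[leRHS]mulrA ler_wpM2r //.
    by rewrite mulr_ge0 ?exprn_ge0 // mulr_ge0 // ltW.
  by rewrite lerXn2r // nnegrE // ltW.
(* From [mu ^+ 4 <= Lmax ^+ 4] and the term [10 * N ^+ 2] of [T]. *)
have g_contract (g : R) : 0 <= g -> g <= g1max -> g * mu * N <= 1.
  move=> g0 gG; have := g_small g g0 gG.
  have mu4 : mu ^+ 2 * mu ^+ 2 <= Lmax ^+ 4.
    by rewrite [Lmax ^+ 4](exprM _ 2 2) -expr2 lerXn2r // nnegrE ltW.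
  have N2 : 0 <= N ^+ 2 by rewrite sqr_ge0.
  have gN2 : 0 <= g ^+ 2 * N ^+ 2 by rewrite mulr_ge0 ?sqr_ge0.
  have H := ler_wpM2l gN2 mu4.
  have gL : 0 <= g ^+ 2 * Lmax ^+ 4 by rewrite mulr_ge0 ?sqr_ge0 // exprn_ge0.
  have gLN := mulr_ge0 gL (ltW N0); have gLN2 := mulr_ge0 gL N2.
  rewrite /T => H1.
  have : mu ^+ 2 * (g * mu * N) ^+ 2 <= mu ^+ 2 * 1 by rewrite !exprMn; lra.
  rewrite ler_pM2l // -[X in _ <= X](expr1n _ 2) ler_pXn2r // nnegrE //.
  by rewrite !mulr_ge0 // ltW.
have Gmu : g1max * mu <= 1.
  apply: le_trans (g_contract _ (ltW G0) (lexx _)).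
  by rewrite ler_peMr // mulr_ge0 // ltW.
have kstar_ge : 64 / (mu ^+ 2 * g1max ^+ 2) <= kstar%:R.
  have c0 : 0 < 64 / (mu ^+ 2 * g1max ^+ 2).
    by rewrite divr_gt0 // mulr_gt0 // exprn_gt0.
  rewrite /kstar natr_absz ger0_norm; first exact: Num.Theory.ceil_ge.
  by rewrite Num.Theory.ceil_ge0; apply: lt_trans c0; rewrite ltrN10.
have kstar0 : (0 < kstar)%N.
  by rewrite -(ltr0n R) (lt_le_trans _ kstar_ge) // divr_gt0 // mulr_gt0 // exprn_gt0.
have g1_bounds k : 0 < g1 k <= g1max.
  rewrite /g1; case: ltnP => [_|kk]; first by rewrite G0 lexx.
  have k0 : 0 <= k%:R :> R by rewrite ler0n.
  have k1 : 0 < k%:R + 1 :> R by lra.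
  rewrite divr_gt0 /=; last 2 first.
  - by lra.
  - by rewrite mulr_gt0 // exprn_gt0.
  have kk' : 64 / (mu ^+ 2 * g1max ^+ 2) <= k%:R.
    by apply: le_trans kstar_ge _; rewrite ler_nat.
  have mg0 : 0 < mu ^+ 2 * g1max ^+ 2 by rewrite mulr_gt0 // exprn_gt0.
  rewrite ler_pdivrMr // -exprMn in kk'.
  rewrite ler_pdivrMr ?mulr_gt0 ?exprn_gt0 // mulrA.
  have a0 : 0 <= g1max * mu by rewrite mulr_ge0 // ltW.
  rewrite [mu * g1max]mulrC in kk'; move: (g1max * mu) a0 Gmu kk' => a a0 a1 kk'.
  (* The choice of [kstar] gives [k * a ^+ 2 >= 64], and [a <= 1] drops one factor; then
     [a * (k + 1) ^+ 2] exceeds [4 * (2 * k + 1)]. *)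
  have ka : 64 <= k%:R * a.
    apply: le_trans kk' _; rewrite ler_wpM2l // expr2.
    by have := ler_wpM2l a0 a1; lra.
  by have := ler_wpM2r k0 ka; lra.
have sigma2_ge0 : 0 <= sigma2.
  by rewrite mulr_ge0 ?invr_ge0 ?ler0n // sumr_ge0 // => i _; rewrite sqr_ge0.
pose C := 96 * Lmax ^+ 2 * (29 + N) * sigma2 / mu ^+ 2.
have C0 : 0 <= C.
  rewrite divr_ge0 ?(ltW mu2) // mulr_ge0 // mulr_ge0; try lra.
pose E := mean_sqdist R n d F g1 g2 z0 zstar K.
have sumE : \sum_i sqn (F i zstar) = N * sigma2.
  rewrite /sigma2 mulrA divff ?gt_eqF // mul1r.
  by apply: eq_bigr => i _; rewrite normv_sqr.
have step k : (k <= K)%N ->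
     E k.+1 <= (1 - g1 k * mu * N / 4) * E k
               + g1 k * mu * N / 4 * (C * g1 k ^+ 2).
  move=> kleK; apply: mean_sqdist_step => // z.
  have /andP[g0 gG] := g1_bounds k.
  apply: le_trans (mean_epoch_bound _ _ _ _ _ _ _ hn mu0 F_mono F_lip F_zs
    _ z g0 muL (g_small _ (ltW g0) gG)) _.
  rewrite ler_wpM2l ?ler0n // lerD2l sumE /C.
  have b0 : 0 <= g1 k ^+ 3 * Lmax ^+ 2 / mu * (N * sigma2).
    rewrite mulr_ge0 ?(mulr_ge0 (ltW N0)) // divr_ge0 ?(ltW mu0) //.
    by rewrite mulr_ge0 ?(ltW L2) // exprn_ge0 // ltW.
  (* The stated constant amounts to [24 * (29 + N)], which dominates the [6 * N + 18] of the epoch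
     bound. *)
  have -> : g1 k * mu * N / 4
      * (96 * Lmax ^+ 2 * (29 + N) * sigma2 / mu ^+ 2 * g1 k ^+ 2)
      = g1 k ^+ 3 * Lmax ^+ 2 / mu * (N * sigma2) * (24 * (29 + N)).
    by field; rewrite gt_eqF.
  by have := mulr_ge0 b0 (ltW N0); lra.
have g1_step k : 0 <= g1 k * mu * N / 4 <= 1.
  have /andP[g0 gG] := g1_bounds k; have := g_contract _ (ltW g0) gG.
  have : 0 <= g1 k * mu * N by rewrite !mulr_ge0 // ltW.
  by move=> H1 H2; apply/andP; split; lra.
have H a b c := decaying_step_recursion R E g1 mu N C g1max kstar K
  mu0 N1 C0 a (mean_sqdist_ge0 _ _ _ _ _ _ _ _ _) b c g1_step step.
have -> : Eperm K (fun pis => normv (seg_rr F g1 g2 pis z0 K.+1 - zstar) ^+ 2)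
        = E K.+1.
  by congr (_ * _); apply: eq_bigr => p _; rewrite normv_sqr.
apply: (le_trans (H _ _ _)) => [|k kk|k kk|].
- by rewrite kstar0.
- by rewrite /g1 kk.
- by rewrite /g1 ltnNge kk.
rewrite {1}/E mean_sqdist0 normv_sqr lerD2l.
rewrite le_eqVlt; apply/orP; left; apply/eqP.
congr (_ * _); rewrite /C; field.
have K1 : 0 < K%:R + 1 :> R by rewrite ltr_wpDl.
by rewrite !gt_eqF.
Qed.
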